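(* Let $a>0$, $n\ge1$, and let $y:[-a,a]\to\mathbb{C}$ be continuous. Let $a_1,\dots,a_n$ be the coefficients (defined in the context) of the quadratic spline $S$ that interpolates $y$ at the $n+1$ equidistant nodes $x_k=-a+kh$, $h=\frac{2a}{n}$, $k=0,\dots,n$. 1) If $y$ is even, then $a_k=a_{n-k+1}$ for $k=1,\dots,n$. 2) If $y$ is odd, then $a_k=-a_{n-k+1}$ for $k=1,\dots,n$.
   Context: Definition of the spline $S$ and its coefficients: with $y_k=y(x_k)$ and $\Delta_j=\frac{y_{j-1}-2y_j+y_{j+1}}{h^2}$ for $1\le j\le n-1$, $S$ is the function equal on $[x_{k-1},x_k]$ ($k=1,\dots,n$) to $$P_k(x)=\frac{x-x_{k-1}}{h}y_k-\frac{x-x_k}{h}y_{k-1}+a_k(x-x_{k-1})(x-x_k),$$ where $$a_1=-\frac1n\sum_{j=1}^{n-1}(n-j)(-1)^j\Delta_j,\qquad a_k=(-1)^{k+1}\Big(a_1+\sum_{j=1}^{k-1}(-1)^j\Delta_j\Big)\quad(2\le k\le n),$$ and empty sums are $0$. (The symbol $a$ without index is the half-length of the interval; $a_k$ with index are the spline coefficients.) *)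

(* Defs.v *)
From HB Require Import structures.
From mathcomp Require Import all_boot all_order all_algebra.
From mathcomp Require Import complex ring.
From mathcomp Require Import all_classical all_reals all_analysis.

Set Implicit Arguments.
Unset Strict Implicit.
Unset Printing Implicit Defensive.

Import Order.TTheory GRing.Theory Num.Theory numFieldNormedType.Exports.
Local Open Scope ring_scope.
Local Open Scope complex_scope.

Definition step (R : realType) (a : R) (n : nat) : R := 2%:R * a / n%:R.

Definition node (R : realType) (a : R) (n k : nat) : R := - a + k%:R * step a n.

(* Intended for 1 <= j <= n - 1, where j.-1 is the true predecessor. *)
Definition second_diff (R : realType) (a : R) (n : nat) (y : R -> R[i])
    (j : nat) : R[i] :=
  (y (node a n j.-1) - 2%:R * y (node a n j) + y (node a n j.+1))
    / (step a n)%:C ^+ 2.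

Definition spline_coef1 (R : realType) (a : R) (n : nat) (y : R -> R[i])
    : R[i] :=
  - (n%:R^-1 * \sum_(1 <= j < n)
                 (n - j)%:R * (-1) ^+ j * second_diff a n y j).

(* Meaningful for 1 <= k <= n; at k = 1 it reduces to spline_coef1
   (spline_coef_1 below). *)
Definition spline_coef (R : realType) (a : R) (n : nat) (y : R -> R[i])
    (k : nat) : R[i] :=
  (-1) ^+ k.+1 *
    (spline_coef1 a n y + \sum_(1 <= j < k) (-1) ^+ j * second_diff a n y j).

(* The polynomial P_k that the spline equals on [x_(k-1), x_k], 1 <= k <= n. *)
Definition spline_piece (R : realType) (a : R) (n : nat) (y : R -> R[i])
    (k : nat) (x : R) : R[i] :=
  ((x - node a n k.-1) / step a n)%:C * y (node a n k)
  - ((x - node a n k) / step a n)%:C * y (node a n k.-1)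
  + spline_coef a n y k * ((x - node a n k.-1) * (x - node a n k))%:C.

Lemma spline_coef_1 (R : realType) (a : R) (n : nat) (y : R -> R[i]) :
  spline_coef a n y 1 = spline_coef1 a n y.
Proof. by rewrite /spline_coef big_geq // addr0 sqrrN expr1n mul1r. Qed.

Lemma spline_piece_interpolates (R : realType) (a : R) (n : nat)
    (y : R -> R[i]) (k : nat) :
  0 < a -> (1 <= k <= n)%N ->
  spline_piece a n y k (node a n k.-1) = y (node a n k.-1) /\
  spline_piece a n y k (node a n k) = y (node a n k).
Proof.
move=> a0 /andP[k1 kn].
have h0 : step a n != 0.
  by rewrite gt_eqF// /step divr_gt0 ?mulr_gt0 ?ltr0n// (leq_trans k1).
have dk : node a n k - node a n k.-1 = step a n.
  by case: k k1 {kn} => // k _; rewrite /node /= -natr1; ring.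
have dk' : node a n k.-1 - node a n k = - step a n by rewrite -dk opprB.
rewrite /spline_piece !subrr dk dk' mulNr divff// !(mul0r, mulr0) rmorphN.
by rewrite !rmorph1 sub0r mulNr opprK !mul1r subr0 !addr0.
Qed.

(* Main.v *)
Require Import Defs.
From HB Require Import structures.
From mathcomp Require Import all_boot all_order all_algebra.
From mathcomp Require Import complex.
From mathcomp Require Import all_classical all_reals all_analysis.
From mathcomp Require Import ring zify.
Import Order.TTheory GRing.Theory Num.Theory numFieldNormedType.Exports.
Local Open Scope classical_set_scope.
Local Open Scope ring_scope.
Local Open Scope complex_scope.

(** If y(-x) = s y(x) with s = 1 or -1, then the signed second differences
    d_j = (-1)^j Delta_j satisfy d_(n-j) = e d_j with e = (-1)^n s.  Writing
    T_k = a_1 + d_1 + ... + d_(k-1), the claim a_k = s a_(n-k+1) reads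
    T_k + e T_(n-k+1) = 0.  Reversing the sum in T_(n-k+1) turns the left side
    into (1 + e) a_1 + D with D = d_1 + ... + d_(n-1); and reversing the sum
    defining a_1 gives n (1 + e) a_1 = - sum_j ((n - j) + j) d_j = - n D. *)

Section ReflectedSums.
Context {F : numFieldType}.
Variables (n : nat) (d : nat -> F) (e : F).
Hypothesis n_gt0 : (0 < n)%N.
Hypothesis e_sq : e * e = 1.
Hypothesis d_refl : forall j, (0 < j < n)%N -> d (n - j)%N = e * d j.

Lemma sum_reflected (k : nat) : (1 <= k <= n)%N ->
  \sum_(1 <= j < n - k + 1) d j = e * \sum_(k <= j < n) d j.
Proof.
move=> /andP[k1 kn].
have -> : \sum_(k <= j < n) d j = \sum_(1 <= j < n - k + 1) d (n - j)%N.
  (* Writing the lower bound as 1 + (k - 1) lets the range be shifted to start at 1 before it is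
     reversed. *)
  rewrite -{1}[k]prednK // -[k.-1.+1]add1n big_addn big_nat_rev /=.
  rewrite (_ : (n - k.-1 = n - k + 1)%N); last by lia.
  by apply: eq_big_nat => i i_bd; congr d; lia.
rewrite mulr_sumr; apply: eq_big_nat => i i_bd.
by rewrite d_refl ?mulrA ?e_sq ?mul1r //; lia.
Qed.

Let c := - (n%:R^-1 * \sum_(1 <= j < n) (n - j)%:R * d j).

Lemma reflected_mean : c + e * c = - \sum_(1 <= j < n) d j.
Proof.
have n0 : n%:R != 0 :> F by rewrite pnatr_eq0 -lt0n.
have weights_rev : e * (\sum_(1 <= j < n) (n - j)%:R * d j)
    = \sum_(1 <= j < n) j%:R * d j.
  rewrite [RHS]big_nat_rev mulr_sumr; apply: eq_big_nat => j j_bd.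
  by rewrite add1n subSS d_refl // mulrCA.
rewrite /c mulrN mulrCA weights_rev -opprD -mulrDr -big_split /=.
(* Multiplying by n clears the inverse; the weights n - j and j then add up to n in each term. *)
congr (- _); apply: (mulfI n0); rewrite mulVKf // mulr_sumr.
apply: eq_big_nat => j /andP[_ jn].
by rewrite -mulrDl -natrD subnK // ltnW.
Qed.

Lemma reflected_partial_sums (k : nat) : (1 <= k <= n)%N ->
  c + \sum_(1 <= j < k) d j
  = - (e * (c + \sum_(1 <= j < n - k + 1) d j)).
Proof.
move=> k_bd; have /andP[k1 kn] := k_bd.
(* As e * e = 1, the reflected sum becomes the tail from k to n - 1, which completes the partial sum
   on the left. *)
apply/eqP; rewrite -addr_eq0 sum_reflected // mulrDr mulrA e_sq mul1r addrACA.
by rewrite reflected_mean -big_cat_nat //= addNr.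
Qed.

End ReflectedSums.

Section SplineSymmetry.
Context {R : realType}.
Variables (a : R) (n : nat) (y : R -> R[i]).
Hypothesis a_gt0 : 0 < a.
Hypothesis n_gt0 : (0 < n)%N.

Lemma node_sub (k : nat) : (k <= n)%N -> node a n (n - k) = - node a n k.
Proof.
move=> kn; have n0 : n%:R != 0 :> R by rewrite pnatr_eq0 -lt0n.
by rewrite /node /step natrB //; field.
Qed.

Lemma node_bounds (k : nat) : (k <= n)%N -> - a <= node a n k <= a.
Proof.
move=> kn; have step_ge0 : 0 <= step a n.
  by rewrite divr_ge0 ?mulr_ge0 ?ler0n // ltW.
have node_ge j : - a <= node a n j by rewrite lerDl mulr_ge0.
(* The upper bound is the lower bound at index n - k, negated. *)
by rewrite node_ge -lerN2 -node_sub // node_ge.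
Qed.

Variable s : R[i].
Hypothesis s_sq : s * s = 1.
Hypothesis y_parity : forall x : R, - a <= x <= a -> y (- x) = s * y x.

Lemma second_diff_sub (j : nat) : (0 < j < n)%N ->
  second_diff a n y (n - j)%N = s * second_diff a n y j.
Proof.
move=> /andP[j0 jn]; rewrite /second_diff.
(* Reflection swaps the two outer nodes of the symmetric stencil; 0 < j < n keeps the truncated
   subtractions exact. *)
have -> : ((n - j).-1 = n - j.+1)%N by lia.
have -> : ((n - j).+1 = n - j.-1)%N by lia.
have yE k : (k <= n)%N -> y (node a n (n - k)) = s * y (node a n k).
  by move=> kn; rewrite node_sub // y_parity // node_bounds.
rewrite !yE; [by ring | lia..].
Qed.

Lemma spline_coef_sub (k : nat) : (1 <= k <= n)%N ->
  spline_coef a n y k = s * spline_coef a n y (n - k + 1)%N.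
Proof.
move=> k_bd; have /andP[k1 kn] := k_bd.
pose d j : R[i] := (-1) ^+ j * second_diff a n y j.
pose e : R[i] := (-1) ^+ n * s.
have e_sq : e * e = 1 by rewrite mulrACA s_sq mulr1 -expr2 sqrr_sign.
have sign_sub j : (j <= n)%N -> (-1) ^+ (n - j) = (-1) ^+ n * (-1) ^+ j :> R[i].
  by move=> jn; rewrite -signr_odd oddB // signr_addb !signr_odd.
have d_refl j : (0 < j < n)%N -> d (n - j)%N = e * d j.
  move=> j_bd; rewrite /d /e second_diff_sub // sign_sub; last by lia.
  by rewrite mulrACA.
rewrite /spline_coef /spline_coef1.
(* Reassociating gives a_1 the shape of [c] for the sequence [d]. *)
under eq_bigr do rewrite -mulrA.
(* The signs agree: (-1)^(k+1) times -(-1)^n is (-1)^(n-k+2), the sign in front of the reflected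
   coefficient, so only the factor s remains. *)
rewrite (@reflected_partial_sums _ n d e) // addn1 !exprS sign_sub // /e.
by ring.
Qed.

End SplineSymmetry.

Theorem mainTheorem3 (R : realType) (a : R) (n : nat) (y : R -> R[i]^o)
    (ha : 0 < a) (hn : (1 <= n)%N) (hy : {within `[- a, a], continuous y}) :
  ((forall x : R, - a <= x <= a -> y (- x) = y x) ->
     forall k : nat, (1 <= k <= n)%N ->
       spline_coef a n y k = spline_coef a n y (n - k + 1)%N) /\
  ((forall x : R, - a <= x <= a -> y (- x) = - y x) ->
     forall k : nat, (1 <= k <= n)%N ->
       spline_coef a n y k = - spline_coef a n y (n - k + 1)%N).
Proof.
split=> y_parity k k_bd.
(* The even and odd cases are s = 1 and s = -1. *)
- rewrite -[RHS]mul1r; apply: spline_coef_sub => //; first by rewrite mulr1.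
  by move=> x x_bd; rewrite mul1r y_parity.
- rewrite -mulN1r; apply: spline_coef_sub => //; first by rewrite mulrNN mulr1.
  by move=> x x_bd; rewrite mulN1r y_parity.
Qed.
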